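(* Let $(H,\alpha)$ be a monoidal Hom-Hopf algebra over a field $k$ with bijective antipode $S$, and let $A,B\in\mathrm{Aut}_{mHH}(H)$. Define the linear map $$\psi(A,B):H\otimes H\to H\otimes H,\qquad a\otimes c\mapsto {}_\psi a\otimes c^\psi=\alpha^2(a_{21})\otimes (B(a_{22})\alpha^{-2}(c))\,AS^{-1}(a_1).$$ Then $(H,H,\psi(A,B))$ is a (left-right) monoidal Hom-entwining structure.
   Context: Sweedler notation is used: $\Delta(c)=c_1\otimes c_2$, $(\mathrm{id}\otimes\Delta)\Delta(c)=c_1\otimes c_{21}\otimes c_{22}$, etc. Everything is over a field $k$. A monoidal Hom-algebra $(A,\alpha)$ is a vector space $A$ with $\alpha\in \mathrm{Aut}_k(A)$ (linear automorphism), a multiplication $A\otimes A\to A$ and $1_A\in A$ such that $\alpha(a)(bc)=(ab)\alpha(c)$, $\alpha(ab)=\alpha(a)\alpha(b)$, $a1_A=1_Aa=\alpha(a)$, $\alpha(1_A)=1_A$. A monoidal Hom-coalgebra $(C,\gamma)$ is a vector space $C$ with $\gamma\in\mathrm{Aut}_k(C)$ and linear maps $\Delta:C\to C\otimes C$, $\varepsilon:C\to k$ such that $\gamma^{-1}(c_1)\otimes\Delta(c_2)=\Delta(c_1)\otimes\gamma^{-1}(c_2)$, $\Delta(\gamma(c))=\gamma(c_1)\otimes\gamma(c_2)$, $c_1\varepsilon(c_2)=\gamma^{-1}(c)=\varepsilon(c_1)c_2$, $\varepsilon(\gamma(c))=\varepsilon(c)$. A monoidal Hom-bialgebra $(H,\alpha)$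 is both (with the same $\alpha$), with $\Delta(hg)=\Delta(h)\Delta(g)$, $\Delta(1_H)=1_H\otimes 1_H$, $\varepsilon(hg)=\varepsilon(h)\varepsilon(g)$, $\varepsilon(1_H)=1$. It is a monoidal Hom-Hopf algebra if there is a linear map (antipode) $S:H\to H$ with $S\alpha=\alpha S$ and $S(h_1)h_2=\varepsilon(h)1_H=h_1S(h_2)$. $\mathrm{Aut}_{mHH}(H)$ is the group of automorphisms of the monoidal Hom-Hopf algebra $H$: bijective linear maps preserving multiplication, unit, comultiplication and counit, and commuting with $\alpha$ and $S$. A left-right monoidal Hom-entwining structure is a triple $(H,C,\psi)$, where $(H,\alpha)$ is a monoidal Hom-algebra, $(C,\gamma)$ is a monoidal Hom-coalgebra and $\psi:H\otimes C\to H\otimes C$, $h\otimes c\mapsto{}_\psi h\otimes c^\psi$, is a linear map such that for all $h,g\in H$, $c\in C$: $${}_\psi(hg)\otimes c^\psi={}_\phi h\,{}_\psi g\otimes\gamma(\gamma^{-1}(c)^{\psi\phi}),$$ $${}_\psi 1_H\otimes c^\psi=1_H\otimes c,$$ $${}_\psi h\otimes\Delta(c^\psi)=\alpha({}_{\phi\psi}\alpha^{-1}(h))\otimes(c_1^{\phi}\otimes c_2^{\psi}),$$ $$\varepsilon(c^\psi)\,{}_\psi h=\varepsilon(c)h.$$ Here $\phi$ denotes a second copy of $\psi$. In the first identity, $\psi$ is applied first, to $g\otimes\gamma^{-1}(c)$, and then $\phi$ is applied to $h\otimes\gamma^{-1}(c)^\psi$. In the third identity, ${}_{\phi\psi}x={}_\phi({}_\psi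 x)$: $\psi$ is applied first, to $\alpha^{-1}(h)\otimes c_2$, and then $\phi$ is applied to ${}_\psi\alpha^{-1}(h)\otimes c_1$. *)

(* Defs.v *)
From HB Require Import structures.
From mathcomp Require Import all_boot all_algebra.
From mathcomp Require Import finmap.
From mathcomp Require Import boolp.
From mathcomp Require Import monalg.

Set Implicit Arguments.
Unset Strict Implicit.
Unset Printing Implicit Defensive.

Import GRing.Theory.
Local Open Scope ring_scope.
Local Open Scope quotient_scope.

(* Tensor product of two (possibly infinite-dimensional) k-modules: the free
   module on V * W modulo the submodule generated by the bilinearity
   relations. *)
Section Tensor.
Variables (k : comNzRingType) (V W : lmodType k).

Let F := {malg k[(V * W)%type]}.
Let gen (v : V) (w : W) : F := << (v, w) >>.

Inductive bilin_rel : F -> Prop :=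
| bilin_rel0 : bilin_rel 0
| bilin_relP (a : k) (x y : F) :
    bilin_rel x -> bilin_rel y -> bilin_rel (a *: x + y)
| bilin_rel_l (a : k) (v v' : V) (w : W) :
    bilin_rel (gen (a *: v + v') w - (a *: gen v w + gen v' w))
| bilin_rel_r (a : k) (v : V) (w w' : W) :
    bilin_rel (gen v (a *: w + w') - (a *: gen v w + gen v w')).

Lemma bilin_relZ a x : bilin_rel x -> bilin_rel (a *: x).
Proof. by move=> h; rewrite -[_ *: _]addr0; apply: bilin_relP h bilin_rel0. Qed.

Definition bilin_sub : {pred F} := fun x => `[< bilin_rel x >].

Lemma bilin_sub_zmod_closed : zmod_closed bilin_sub.
Proof.
split=> [|x y /asboolP hx /asboolP hy]; apply/asboolP; first exact: bilin_rel0.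
by rewrite addrC -scaleN1r; apply: bilin_relP.
Qed.

HB.instance Definition _ :=
  GRing.isZmodClosed.Build F bilin_sub bilin_sub_zmod_closed.

Definition tensor := @Quotient.quot F (GRing.ZmodClosed.clone F bilin_sub _).

HB.instance Definition _ := GRing.Zmodule.on tensor.
HB.instance Definition _ := EqQuotient.on tensor.

Local Notation pi := (\pi_tensor).

Lemma tensor_piP (x y : F) : reflect (bilin_rel (x - y)) (pi x == pi y).
Proof. by rewrite -Quotient.idealrBE; apply: asboolP. Qed.

Lemma tensor_piD x y : pi (x + y) = pi x + pi y.
Proof. by rewrite Quotient.pi_add. Qed.

Lemma repr_piP (x : F) : bilin_rel (repr (pi x) - x).
Proof. by apply/tensor_piP; rewrite reprK. Qed.

Definition tscale (a : k) (t : tensor) : tensor := pi (a *: repr t).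

Lemma tensor_pi_scale a x : tscale a (pi x) = pi (a *: x).
Proof.
by apply/eqP/tensor_piP; rewrite -scalerBr; apply/bilin_relZ/repr_piP.
Qed.

Lemma tscaleA a b t : tscale a (tscale b t) = tscale (a * b) t.
Proof. by rewrite -[t]reprK (tensor_pi_scale b) !tensor_pi_scale scalerA. Qed.

Lemma tscale1 : left_id 1 tscale.
Proof. by move=> t; rewrite -[t]reprK tensor_pi_scale scale1r. Qed.

Lemma tscaleDr : right_distributive tscale +%R.
Proof.
move=> a s t; rewrite -[s]reprK -[t]reprK -tensor_piD !tensor_pi_scale.
by rewrite -tensor_piD scalerDr.
Qed.

Lemma tscaleDl t : {morph tscale^~ t : a b / a + b}.
Proof.
by move=> a b; rewrite -[t]reprK !tensor_pi_scale -tensor_piD scalerDl.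
Qed.

HB.instance Definition _ :=
  GRing.Zmodule_isLmodule.Build k tensor tscaleA tscale1 tscaleDr tscaleDl.

Lemma tensor_piZ a x : pi (a *: x) = a *: pi x.
Proof. by rewrite -tensor_pi_scale. Qed.

Definition tens (v : V) (w : W) : tensor := pi (gen v w).

Lemma tens_linearl w : linear (tens^~ w).
Proof.
move=> a v v'; rewrite -tensor_piZ -tensor_piD.
exact/eqP/tensor_piP/bilin_rel_l.
Qed.

Lemma tens_linearr v : linear (tens v).
Proof.
move=> a w w'; rewrite -tensor_piZ -tensor_piD.
exact/eqP/tensor_piP/bilin_rel_r.
Qed.

(* Evaluation of f on a chosen representative of t.  This is the linear map
   induced by f when f is bilinear (lemmas [tlift_linear] and [tlift_tens]
   below); for other f the value depends on the representative. *)
Definition tlift (U : lmodType k) (f : V -> W -> U) (t : tensor) : U :=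
  let x : F := repr t in
  \sum_(p <- msupp x) x@_p *: f p.1 p.2.

Section Universal.
Variables (U : lmodType k) (f : V -> W -> U).

Let ev (x : F) : U := \sum_(p <- msupp x) x@_p *: f p.1 p.2.

Let evEw (d : {fset V * W}) (x : F) : (msupp x `<=` d)%fset ->
  ev x = \sum_(p <- d) x@_p *: f p.1 p.2.
Proof.
move=> le; rewrite /ev (big_fset_incl _ le) // => p _ /mcoeff_outdom ->.
by rewrite scale0r.
Qed.

Let ev_linear : linear ev.
Proof.
move=> a x y; pose d := (msupp x `|` msupp y)%fset.
have lx : (msupp x `<=` d)%fset by apply: fsubsetUl.
have ly : (msupp y `<=` d)%fset by apply: fsubsetUr.
have lxy : (msupp (a *: x + y) `<=` d)%fset.
  apply: fsubset_trans (msuppD_le _ _) _.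
  by rewrite fsubUset ly andbT (fsubset_trans (msuppZ_le _ _)).
rewrite (evEw lx) (evEw ly) (evEw lxy) scaler_sumr -big_split /=.
by apply: eq_bigr => p _; rewrite mcoeffD mcoeffZ scalerDl scalerA.
Qed.

Let evU v w : ev (gen v w) = f v w.
Proof.
by rewrite /ev msuppU oner_eq0 big_seq_fset1 mcoeffUU scale1r.
Qed.

Hypothesis f_l : forall w, linear (f^~ w).
Hypothesis f_r : forall v, linear (f v).

Let ev_rel (x : F) : bilin_rel x -> ev x = 0.
Proof.
have evB (y z : F) : ev (y - z) = ev y - ev z.
  by rewrite addrC -[- z]scaleN1r ev_linear scaleN1r addrC.
elim=> {x} [|a x y _ hx _ hy|a v v' w|a v w w'].
- by rewrite /ev msupp0 big_seq_fset0.
- by rewrite ev_linear hx hy scaler0 addr0.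
- by rewrite evB ev_linear !evU f_l subrr.
- by rewrite evB ev_linear !evU f_r subrr.
Qed.

Let tlift_pi (x : F) : tlift f (pi x) = ev x.
Proof.
rewrite -[LHS]/(ev (repr (pi x))).
set y := repr _.
have -> : y = 1 *: (y - x) + x by rewrite scale1r subrK.
by rewrite ev_linear ev_rel ?scaler0 ?add0r //; apply: repr_piP.
Qed.

Lemma tlift_linear : linear (tlift f).
Proof.
move=> a s t; rewrite -[s]reprK -[t]reprK -tensor_piZ -tensor_piD.
by rewrite !tlift_pi ev_linear.
Qed.

Lemma tlift_tens v w : tlift f (tens v w) = f v w.
Proof. by rewrite tlift_pi evU. Qed.

Lemma tlift_unique (g : tensor -> U) :
  linear g -> (forall v w, g (tens v w) = f v w) -> g =1 tlift f.
Proof.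
move=> gl gE t; rewrite -[t]reprK tlift_pi.
have pi0 : pi 0 = 0 by rewrite -(scale0r (0 : F)) tensor_piZ scale0r.
have g0 : g 0 = 0 by have := gl (-1) 0 0; rewrite !scaleN1r !addNr.
rewrite {1}[repr t]monalgE /ev.
elim: (enum_fset _) => [|p r IH]; first by rewrite !big_nil pi0.
rewrite !big_cons tensor_piD -IH -gE -gl; congr (g (_ + _)).
rewrite -tensor_piZ; congr (pi _); case: p => v w.
by apply/malgP => q; rewrite mcoeffZ !mcoeffU mulrnAr mulr1.
Qed.

End Universal.
End Tensor.

Reserved Notation "v ⊗ w" (at level 40, left associativity).
Notation "V ⊗ W" := (tensor V W) : type_scope.
Notation "v ⊗ w" := (tens v w) : ring_scope.

(* Sweedler notation: for t = Delta c, \sw_(c1, c2 <- t) E stands for E with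
   the summation over the components of t understood.  E must be bilinear in
   (c1, c2); see [tlift]. *)
Reserved Notation "\sw_ ( a , b <- t ) E"
  (at level 41, a name, b name, E at level 41,
   format "'[' \sw_ ( a ,  b  <-  t ) '/  '  E ']'").
Notation "\sw_ ( a , b <- t ) E" := (tlift (fun a b => E) t) : ring_scope.

(* [twist] is the structure automorphism (alpha or gamma), [untwist] its
   inverse. *)
HB.mixin Record isHomModule (k : fieldType) V of GRing.Lmodule k V := {
  twist : {linear V -> V};
  untwist : V -> V;
  twistK : cancel twist untwist;
  untwistK : cancel untwist twist
}.
#[short(type="homModType")]
HB.structure Definition HomModule (k : fieldType) :=
  {V of GRing.Lmodule k V & isHomModule k V}.

HB.mixin Record isHomAlgebra (k : fieldType) A of HomModule k A := {
  hmul : A -> A -> A;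
  hone : A;
  hmul_linearl : forall b, linear (hmul^~ b);
  hmul_linearr : forall a, linear (hmul a);
  hmulA : forall a b c, hmul (twist a) (hmul b c) = hmul (hmul a b) (twist c);
  twistM : forall a b, twist (hmul a b) = hmul (twist a) (twist b);
  hmul1 : forall a, hmul a hone = twist a;
  hmul1l : forall a, hmul hone a = twist a;
  twist1 : twist hone = hone
}.
#[short(type="homAlgType")]
HB.structure Definition HomAlgebra (k : fieldType) :=
  {A of HomModule k A & isHomAlgebra k A}.

HB.mixin Record isHomCoalgebra (k : fieldType) C of HomModule k C := {
  hcomul : {linear C -> (C ⊗ C)%type};
  hcounit : {scalar C};
  hcomulA : forall c,
    \sw_(c1, c2 <- hcomul c) (untwist c1 ⊗ hcomul c2)
    = \sw_(c1, c2 <- hcomul c) \sw_(c11, c12 <- hcomul c1)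
        (c11 ⊗ (c12 ⊗ untwist c2));
  hcomul_twist : forall c,
    hcomul (twist c) = \sw_(c1, c2 <- hcomul c) (twist c1 ⊗ twist c2);
  hcounitr : forall c, \sw_(c1, c2 <- hcomul c) (hcounit c2 *: c1) = untwist c;
  hcounitl : forall c, \sw_(c1, c2 <- hcomul c) (hcounit c1 *: c2) = untwist c;
  hcounit_twist : forall c, hcounit (twist c) = hcounit c
}.
#[short(type="homCoalgType")]
HB.structure Definition HomCoalgebra (k : fieldType) :=
  {C of HomModule k C & isHomCoalgebra k C}.

HB.mixin Record isHomBialgebra (k : fieldType) H
    of HomAlgebra k H & HomCoalgebra k H := {
  hcomulM : forall h g : H,
    hcomul (hmul h g)
    = \sw_(h1, h2 <- hcomul h) \sw_(g1, g2 <- hcomul g)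
        (hmul h1 g1 ⊗ hmul h2 g2);
  hcomul1 : hcomul (hone : H) = hone ⊗ hone;
  hcounitM : forall h g : H, hcounit (hmul h g) = hcounit h * hcounit g;
  hcounit1 : hcounit (hone : H) = 1
}.
#[short(type="homBialgType")]
HB.structure Definition HomBialgebra (k : fieldType) :=
  {H of HomAlgebra k H & HomCoalgebra k H & isHomBialgebra k H}.

HB.mixin Record isHomHopf (k : fieldType) H of HomBialgebra k H := {
  antipode : {linear H -> H};
  antipode_twist : forall h, antipode (twist h) = twist (antipode h);
  antipodel : forall h : H,
    \sw_(h1, h2 <- hcomul h) (hmul (antipode h1) h2) = hcounit h *: hone;
  antipoder : forall h : H,
    \sw_(h1, h2 <- hcomul h) (hmul h1 (antipode h2)) = hcounit h *: hone
}.
#[short(type="homHopfType")]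
HB.structure Definition HomHopf (k : fieldType) :=
  {H of HomBialgebra k H & isHomHopf k H}.

Record homHopfAut (k : fieldType) (H : homHopfType k) := HomHopfAut {
  aut_map :> {linear H -> H};
  aut_bij : bijective aut_map;
  autM : forall h g, aut_map (hmul h g) = hmul (aut_map h) (aut_map g);
  aut1 : aut_map hone = hone;
  aut_comul : forall h,
    hcomul (aut_map h) = \sw_(h1, h2 <- hcomul h) (aut_map h1 ⊗ aut_map h2);
  aut_counit : forall h, hcounit (aut_map h) = hcounit h;
  aut_twist : forall h, aut_map (twist h) = twist (aut_map h);
  aut_antipode : forall h, aut_map (antipode h) = antipode (aut_map h)
}.

(* (H, C, psi) is a left-right monoidal Hom-entwining structure.  In
   [entw_mul], psi acts first on g ⊗ gamma^-1(c), then on h; in [entw_comul],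
   psi acts first on alpha^-1(h) ⊗ c2, then on the result and c1. *)
Record hom_entwining (k : fieldType) (H : homAlgType k) (C : homCoalgType k)
    (psi : H ⊗ C -> H ⊗ C) : Prop := HomEntwining {
  entw_linear : linear psi;
  entw_mul : forall (h g : H) (c : C),
    psi (hmul h g ⊗ c)
    = \sw_(g', d <- psi (g ⊗ untwist c)) \sw_(h', e <- psi (h ⊗ d))
        (hmul h' g' ⊗ twist e);
  entw_one : forall c : C, psi (hone ⊗ c) = hone ⊗ c;
  entw_comul : forall (h : H) (c : C),
    \sw_(h', c' <- psi (h ⊗ c)) (h' ⊗ hcomul c')
    = \sw_(c1, c2 <- hcomul c) \sw_(h', c2' <- psi (untwist h ⊗ c2))
        \sw_(h'', c1' <- psi (h' ⊗ c1)) (twist h'' ⊗ (c1' ⊗ c2'));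
  entw_counit : forall (h : H) (c : C),
    \sw_(h', c' <- psi (h ⊗ c)) (hcounit c' *: h') = hcounit c *: h
}.

(* Sinv stands for the inverse of the antipode; the summand is bilinear in
   (a, c) in that case. *)
Definition entw_map (k : fieldType) (H : homHopfType k)
    (Sinv : H -> H) (A B : homHopfAut H) : H ⊗ H -> H ⊗ H :=
  tlift (fun a c : H =>
    \sw_(a1, a2 <- hcomul a) \sw_(a21, a22 <- hcomul a2)
      (twist (twist a21)
         ⊗ hmul (hmul (B a22) (untwist (untwist c))) (A (Sinv a1)))).

(* Main.v *)
Require Import Defs.
From mathcomp Require Import all_boot all_algebra.

Set Implicit Arguments.
Unset Strict Implicit.
Unset Printing Implicit Defensive.

Import GRing.Theory.
Local Open Scope ring_scope.

(** The structure automorphism can be scaled away.  Writing [α] for it, the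
    operations [a • b = α^-1 (a b)] and [Δ h = hcomul (α h)] turn a monoidal
    Hom-bialgebra into an ordinary bialgebra with the same unit and counit
    (definition [untwisted]), of which [α] is an automorphism
    ([twist_morphism]); antipodes and automorphisms stay what they are.  All the
    powers of [α] in the definition of [ψ(A, B)] are exactly those needed to make
    them disappear ([entw_mapE]): with [Q = A S^-1] and ordinary Sweedler
    indices,

      [ψ(a ⊗ c) = a_2 ⊗ B(a_3) c Q(a_1)].

    For an ordinary bialgebra this map satisfies the four axioms of an
    entwining as soon as [B] is a bialgebra map and [Q] reverses products and
    coproducts.  On a product, [B(a_3 b_3) c Q(a_1 b_1)] is
    [B(a_3) (B(b_3) c Q(b_1)) Q(a_1)], that is, [ψ] applied first along [b] and
    then along [a] ([yd_entw_mul]).  Dually, the coproduct of [B(a_3) c Q(a_1)]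
    splits [a_3] in order and [a_1] in reverse order, so that the five
    components of [a] nest around [a_3], the inner pair going to [c_1] and the
    outer pair to [c_2] ([yd_entw_cop]).

    That [Q] reverses products and coproducts comes from the antipode:
    [S] is an anti-morphism because [(a, b) |-> S(a b)] and
    [(a, b) |-> S(b) S(a)] are a left and a right convolution inverse of the
    product, and likewise for the coproduct ([antipode_mul], [antipode_cop]);
    the property passes to [S^-1].

    The Hom-axioms follow from the ordinary ones, because [ψ] commutes with
    [α ⊗ α] ([yd_entw_natural]). *)

(** * Linear maps out of a tensor product *)

Section TensorCalculus.
Variables (k : comNzRingType) (V W : lmodType k).

Lemma linear_idfun : linear (fun v : V => v).
Proof. by []. Qed.

Lemma linear_comp (U : lmodType k) (g : W -> U) (f : V -> W) :
  linear g -> linear f -> linear (fun v => g (f v)).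
Proof. by move=> gl fl a u v; rewrite fl gl. Qed.

Lemma linear_scale (a : k) : linear (fun v : V => a *: v).
Proof. by move=> b u v; rewrite scalerDr !scalerA mulrC. Qed.

Lemma linear_scalel (e : V -> k) (w : W) :
  scalar e -> linear (fun v => e v *: w).
Proof. by move=> el a u v; rewrite el scalerDl scalerA. Qed.

(** For a fixed [t], [tlift] is a finite sum over a fixed representative of [t],
    hence linear in whatever its summand is linear in. *)
Lemma linear_tlift_fun (U X : lmodType k) (F : X -> V -> W -> U)
    (t : (V ⊗ W)%type) :
  (forall v w, linear (fun x => F x v w)) -> linear (fun x => tlift (F x) t).
Proof.
move=> Fl a x y; rewrite /tlift scaler_sumr -big_split /=.
by apply: eq_bigr => p _; rewrite Fl scalerDr !scalerA mulrC.
Qed.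

Lemma linear_tlift_arg (U X : lmodType k) (F : V -> W -> U)
    (g : X -> (V ⊗ W)%type) :
    (forall w, linear (fun v => F v w)) -> (forall v, linear (fun w => F v w)) ->
  linear g -> linear (fun x => tlift F (g x)).
Proof. by move=> Fl Fr gl a x y; rewrite gl tlift_linear. Qed.

Lemma tlift_ext (U : lmodType k) (f g : V -> W -> U) (t : (V ⊗ W)%type) :
  (forall v w, f v w = g v w) -> tlift f t = tlift g t.
Proof. by move=> fg; apply: eq_bigr => p _; rewrite fg. Qed.

Lemma linear_scaleE (U X : lmodType k) (g : U -> X) :
  linear g -> forall a u, g (a *: u) = a *: g u.
Proof.
move=> gl a u; have g0 : g 0 = 0.
  by have := gl (-1) 0 0; rewrite !scaleN1r !addNr.
by have := gl a u 0; rewrite g0 !addr0.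
Qed.

Lemma linear_tlift (U X : lmodType k) (g : U -> X) (gl : linear g)
    (f : V -> W -> U) (t : (V ⊗ W)%type) :
  g (tlift f t) = tlift (fun v w => g (f v w)) t.
Proof.
have gD : {morph g : u v / u + v}.
  by move=> u v; have := gl 1 u v; rewrite !scale1r.
have g0 : g 0 = 0 by have := linear_scaleE gl 0 0; rewrite !scale0r.
rewrite /tlift (big_morph g gD g0); apply: eq_bigr => p _.
exact: linear_scaleE.
Qed.

(** Both sides are finite sums over fixed representatives of [s] and [t]. *)
Lemma exchange_tlift (U V' W' : lmodType k) (F : V -> W -> V' -> W' -> U)
    (s : (V ⊗ W)%type) (t : (V' ⊗ W')%type) :
  \sw_(a, b <- s) \sw_(c, d <- t) F a b c d
  = \sw_(c, d <- t) \sw_(a, b <- s) F a b c d.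
Proof.
rewrite /tlift; under eq_bigr do rewrite scaler_sumr.
rewrite exchange_big; apply: eq_bigr => p _; rewrite scaler_sumr.
by apply: eq_bigr => q _; rewrite !scalerA mulrC.
Qed.

Lemma eq_on_tens (U : lmodType k) (f g : (V ⊗ W)%type -> U) :
    linear f -> linear g -> (forall v w, f (v ⊗ w) = g (v ⊗ w)) ->
  forall t, f t = g t.
Proof.
move=> fl gl fg t.
pose F v w := f (v ⊗ w).
have Fl w : linear (F^~ w) by move=> a u v; rewrite /F tens_linearl fl.
have Fr v : linear (F v) by move=> a u w; rewrite /F tens_linearr fl.
have fE := tlift_unique Fl Fr fl (fun v w => erefl).
by rewrite fE (tlift_unique Fl Fr gl) // => v w; rewrite /F fg.
Qed.

End TensorCalculus.

Lemma tlift_tlift (k : comNzRingType) (V W U V' W' : lmodType k)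
    (F : V -> W -> U) (G : V' -> W' -> (V ⊗ W)%type) (t : (V' ⊗ W')%type) :
    (forall w, linear (fun v => F v w)) -> (forall v, linear (fun w => F v w)) ->
  tlift F (tlift G t) = \sw_(a, b <- t) tlift F (G a b).
Proof. by move=> Fl Fr; rewrite (linear_tlift (tlift_linear Fl Fr)). Qed.

Lemma tlift_eta (k : comNzRingType) (V W : lmodType k) (t : (V ⊗ W)%type) :
  \sw_(a, b <- t) (a ⊗ b) = t.
Proof.
by rewrite -(tlift_unique (@tens_linearl _ V W) (@tens_linearr _ V W) (g := id)).
Qed.

(** * Ordinary bialgebras *)

(** The carrier is a bare module and the operations are plain functions, so that
    the module underlying a Hom-bialgebra can carry this second structure next
    to its own. *)
Record bialgebra (k : comNzRingType) (V : lmodType k) := Bialgebra {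
  mu : V -> V -> V;
  unit_elt : V;
  cop : V -> (V ⊗ V)%type;
  eps : V -> k;
  mu_linearl : forall b, linear (mu^~ b);
  mu_linearr : forall a, linear (mu a);
  cop_linear : linear cop;
  eps_linear : scalar eps;
  muA : forall a b c, mu a (mu b c) = mu (mu a b) c;
  mu1l : forall a, mu unit_elt a = a;
  mu1r : forall a, mu a unit_elt = a;
  copA : forall h,
    \sw_(x, y <- cop h) (x ⊗ cop y)
    = \sw_(x, y <- cop h) \sw_(x1, x2 <- cop x) (x1 ⊗ (x2 ⊗ y));
  cop_epsr : forall h, \sw_(x, y <- cop h) (eps y *: x) = h;
  cop_epsl : forall h, \sw_(x, y <- cop h) (eps x *: y) = h;
  copM : forall a b,
    cop (mu a b)
    = \sw_(a1, a2 <- cop a) \sw_(b1, b2 <- cop b) (mu a1 b1 ⊗ mu a2 b2);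
  cop1 : cop unit_elt = unit_elt ⊗ unit_elt;
  epsM : forall a b, eps (mu a b) = eps a * eps b;
  eps1 : eps unit_elt = 1
}.

(** Every rearrangement of Sweedler sums has to be justified by the
    multilinearity of its summand; [multilinear] proves this by following the
    argument down the syntax tree of the summand, in which it occurs once.  The
    local hypotheses tried last provide the linear maps that are not operations
    of a bialgebra. *)
Ltac linear_leaf :=
  match goal with
  | |- GRing.linear_for _ (fun x => x) => exact: linear_idfun
  | |- GRing.linear_for _ (fun x => tens x _) => exact: tens_linearl
  | |- GRing.linear_for _ (fun x => tens _ x) => exact: tens_linearr
  | |- GRing.linear_for _ (fun x => GRing.scale _ x) => exact: linear_scale
  | |- GRing.linear_for _ (fun x => mu _ x _) => exact: mu_linearl
  | |- GRing.linear_for _ (fun x => mu _ _ x) => exact: mu_linearr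
  | |- GRing.linear_for _ (fun x => cop _ x) => exact: cop_linear
  | |- GRing.linear_for _ (fun x => GRing.scale (eps _ x) _) =>
      exact: (linear_scalel _ (eps_linear _))
  | H : _ |- _ => solve [simple apply H]
  end.

(** An argument that is an immediate operand is left to [linear_leaf]: peeling
    off a composition with the identity would loop. *)
Ltac multilinear_step :=
  match goal with
  | |- GRing.linear_for _ (fun x__ => tlift (@?F x__) ?t) =>
      apply: (@linear_tlift_fun _ _ _ _ _ F t)
  | |- GRing.linear_for _ (fun x__ => tlift ?F (@?t x__)) =>
      apply: (@linear_tlift_arg _ _ _ _ _ F t)
  | |- GRing.linear_for _ (fun x__ => GRing.scale (?e (@?f x__)) ?v) =>
      lazymatch f with
      | (fun x__ => x__) => fail
      | _ => apply: (linear_comp (g := fun y => GRing.scale (e y) v) (f := f))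
      end
  | |- GRing.linear_for _ (fun x__ => ?g (@?f x__)) =>
      lazymatch f with
      | (fun x__ => x__) => fail
      | _ => apply: (linear_comp (g := fun y => g y) (f := f))
      end
  | |- GRing.linear_for _ (fun x__ => ?g (@?f x__) ?b) =>
      lazymatch f with
      | (fun x__ => x__) => fail
      | _ => apply: (linear_comp (g := fun y => g y b) (f := f))
      end
  | |- GRing.linear_for _ (fun x__ => ?g (@?f x__) ?b ?c) =>
      lazymatch f with
      | (fun x__ => x__) => fail
      | _ => apply: (linear_comp (g := fun y => g y b c) (f := f))
      end
  end.

Ltac multilinear :=
  cbv beta;
  lazymatch goal with
  | |- forall _, _ => intro; multilinear
  | _ => first
    [ linear_leaf
    | multilinear_step; multilinear ]
  end.

Record bialg_morphism (k : comNzRingType) (V : lmodType k) (K : bialgebra V)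
    (f : V -> V) : Prop := BialgMorphism {
  mor_linear : linear f;
  morM : forall a b, f (mu K a b) = mu K (f a) (f b);
  mor1 : f (unit_elt K) = unit_elt K;
  mor_cop : forall h, cop K (f h) = \sw_(x, y <- cop K h) (f x ⊗ f y);
  mor_eps : forall h, eps K (f h) = eps K h
}.

Record bialg_antimorphism (k : comNzRingType) (V : lmodType k)
    (K : bialgebra V) (f : V -> V) : Prop := BialgAntimorphism {
  anti_linear : linear f;
  antiM : forall a b, f (mu K a b) = mu K (f b) (f a);
  anti1 : f (unit_elt K) = unit_elt K;
  anti_cop : forall h, cop K (f h) = \sw_(x, y <- cop K h) (f y ⊗ f x);
  anti_eps : forall h, eps K (f h) = eps K h
}.

(** * Sweedler calculus *)

Section Bialgebra.
Variables (k : comNzRingType) (V : lmodType k) (K : bialgebra V).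

Local Notation "a • b" := (mu K a b) (at level 39, left associativity).
Local Notation Δ := (cop K).
Local Notation ε := (eps K).
Local Notation "𝟙" := (unit_elt K).

Section Sweedler.
Variable U : lmodType k.

Lemma sw_coassoc (F : V -> V -> V -> U) (h : V) :
    (forall y z, linear (fun x => F x y z)) ->
    (forall x z, linear (fun y => F x y z)) ->
    (forall x y, linear (fun z => F x y z)) ->
  \sw_(x, y <- Δ h) \sw_(y1, y2 <- Δ y) F x y1 y2
  = \sw_(x, y <- Δ h) \sw_(x1, x2 <- Δ x) F x1 x2 y.
Proof.
move=> F1 F2 F3.
pose G (x : V) (s : (V ⊗ V)%type) := tlift (F x) s.
have G1 s : linear (fun x => G x s) by rewrite /G; multilinear.
have G2 x : linear (G x) by apply: tlift_linear; multilinear.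
have := congr1 (tlift G) (copA K h).
rewrite !tlift_tlift; [|multilinear..].
under tlift_ext do [rewrite tlift_tens; [|multilinear..]].
move=> ->; apply: tlift_ext => x y.
rewrite tlift_tlift; [|multilinear..].
apply: tlift_ext => x1 x2; rewrite tlift_tens; [|multilinear..].
by rewrite /G tlift_tens; [|multilinear..].
Qed.

Lemma sw_epsr (f : V -> U) (h : V) :
  linear f -> \sw_(x, y <- Δ h) (ε y *: f x) = f h.
Proof.
move=> fl; rewrite -[in RHS](cop_epsr K h) (linear_tlift fl).
by apply: tlift_ext => x y; rewrite linear_scaleE.
Qed.

Lemma sw_epsl (f : V -> U) (h : V) :
  linear f -> \sw_(x, y <- Δ h) (ε x *: f y) = f h.
Proof.
move=> fl; rewrite -[in RHS](cop_epsl K h) (linear_tlift fl).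
by apply: tlift_ext => x y; rewrite linear_scaleE.
Qed.

Lemma sw_copM (F : V -> V -> U) (a b : V) :
    (forall y, linear (fun x => F x y)) -> (forall x, linear (fun y => F x y)) ->
  \sw_(x, y <- Δ (a • b)) F x y
  = \sw_(a1, a2 <- Δ a) \sw_(b1, b2 <- Δ b) F (a1 • b1) (a2 • b2).
Proof.
move=> F1 F2; rewrite copM tlift_tlift; [|multilinear..].
apply: tlift_ext => a1 a2; rewrite tlift_tlift; [|multilinear..].
by apply: tlift_ext => b1 b2; rewrite tlift_tens.
Qed.

(** The left-hand side arises by cutting [h] into three and refining the two
    ends, the right-hand side by cutting [h] into three and refining the middle
    into three again. *)
Lemma sw_coassoc5 (F : V -> V -> V -> V -> V -> U) (h : V) :
    (forall b c d e, linear (fun a => F a b c d e)) ->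
    (forall a c d e, linear (fun b => F a b c d e)) ->
    (forall a b d e, linear (fun c => F a b c d e)) ->
    (forall a b c e, linear (fun d => F a b c d e)) ->
    (forall a b c d, linear (fun e => F a b c d e)) ->
  \sw_(x, y <- Δ h) \sw_(a, b <- Δ x) \sw_(c, z <- Δ y) \sw_(d, e <- Δ z)
    F a b c d e
  = \sw_(a, y <- Δ h) \sw_(z, e <- Δ y) \sw_(b, w <- Δ z) \sw_(c, d <- Δ w)
    F a b c d e.
Proof.
move=> F1 F2 F3 F4 F5.
rewrite -(sw_coassoc (F := fun a b y =>
  \sw_(c, z <- Δ y) \sw_(d, e <- Δ z) F a b c d e)); [|multilinear..].
apply: tlift_ext => a y.
under tlift_ext => b w do [rewrite (sw_coassoc (F := F a b)); [|multilinear..]].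
by rewrite (sw_coassoc (F := fun b w e => \sw_(c, d <- Δ w) F a b c d e));
  [|multilinear..].
Qed.

End Sweedler.

(** * The algebra [V ⊗ V] *)

Section TensorProductAlgebra.

Definition tmul (s t : (V ⊗ V)%type) : (V ⊗ V)%type :=
  \sw_(a, b <- s) \sw_(c, d <- t) (a • c ⊗ b • d).

Lemma tmul_linearl t : linear (tmul^~ t).
Proof. by apply: tlift_linear; multilinear. Qed.

Lemma tmul_linearr s : linear (tmul s).
Proof. by rewrite /tmul; multilinear. Qed.

Lemma tmul_tens a b c d : tmul (a ⊗ b) (c ⊗ d) = a • c ⊗ b • d.
Proof.
rewrite /tmul [LHS]tlift_tens; [|multilinear..].
by rewrite [LHS]tlift_tens; [|multilinear..].
Qed.

Lemma tmulA s t u : tmul s (tmul t u) = tmul (tmul s t) u.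
Proof.
have L := tmul_linearl; have R := tmul_linearr.
move: s; apply: eq_on_tens; [multilinear..|move=> a b].
move: t; apply: eq_on_tens; [multilinear..|move=> c d].
move: u; apply: eq_on_tens; [multilinear..|move=> e f].
by rewrite !tmul_tens !muA.
Qed.

Lemma tmul1l t : tmul (𝟙 ⊗ 𝟙) t = t.
Proof.
have L := tmul_linearl; have R := tmul_linearr.
move: t; apply: eq_on_tens; [multilinear..|move=> a b].
by rewrite tmul_tens !mu1l.
Qed.

Lemma tmul1r t : tmul t (𝟙 ⊗ 𝟙) = t.
Proof.
have L := tmul_linearl; have R := tmul_linearr.
move: t; apply: eq_on_tens; [multilinear..|move=> a b].
by rewrite tmul_tens !mu1r.
Qed.

Lemma cop_tmul a b : Δ (a • b) = tmul (Δ a) (Δ b).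
Proof. exact: copM. Qed.

End TensorProductAlgebra.

(** * The entwining attached to a morphism and an anti-morphism *)

Section Entwining.
Variables B Q : V -> V.
Hypotheses (Bm : bialg_morphism K B) (Qm : bialg_antimorphism K Q).
Let Bl : linear B := mor_linear Bm.
Let Ql : linear Q := anti_linear Qm.

Definition yd_entw : (V ⊗ V)%type -> (V ⊗ V)%type :=
  tlift (fun a c =>
    \sw_(a1, y <- Δ a) \sw_(a2, a3 <- Δ y) (a2 ⊗ (B a3 • c • Q a1))).
Local Notation ψ := yd_entw.

Lemma yd_entw_linear : linear ψ.
Proof. by apply: tlift_linear; multilinear. Qed.

Lemma yd_entw_tens (a c : V) :
  ψ (a ⊗ c) = \sw_(a1, y <- Δ a) \sw_(a2, a3 <- Δ y) (a2 ⊗ (B a3 • c • Q a1)).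
Proof. by rewrite /yd_entw tlift_tens; [|multilinear..]. Qed.

Lemma sw_yd_entw (U : lmodType k) (F : V -> V -> U) (a c : V) :
    (forall y, linear (fun x => F x y)) -> (forall x, linear (fun y => F x y)) ->
  \sw_(a', c' <- ψ (a ⊗ c)) F a' c'
  = \sw_(a1, y <- Δ a) \sw_(a2, a3 <- Δ y) F a2 (B a3 • c • Q a1).
Proof.
move=> F1 F2; rewrite yd_entw_tens tlift_tlift; [|multilinear..].
apply: tlift_ext => a1 y; rewrite tlift_tlift; [|multilinear..].
by apply: tlift_ext => a2 a3; rewrite tlift_tens.
Qed.

(** Both sides are [a_2 b_2 ⊗ B(a_3) B(b_3) c Q(b_1) Q(a_1)]: it is because
    [Q] reverses products that the factors of [b] stay next to [c]. *)
Lemma yd_entw_mul (a b c : V) :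
  ψ (a • b ⊗ c)
  = \sw_(b', d <- ψ (b ⊗ c)) \sw_(a', e <- ψ (a ⊗ d)) (a' • b' ⊗ e).
Proof.
transitivity (
    \sw_(a1, y <- Δ a) \sw_(b1, z <- Δ b) \sw_(a2, a3 <- Δ y)
      \sw_(b2, b3 <- Δ z)
        (a2 • b2 ⊗ (B a3 • (B b3 • c • Q b1) • Q a1))).
- rewrite yd_entw_tens [LHS]sw_copM; [|multilinear..].
  apply: tlift_ext => a1 y; apply: tlift_ext => b1 z.
  rewrite [LHS]sw_copM; [|multilinear..].
  apply: tlift_ext => a2 a3; apply: tlift_ext => b2 b3.
  by rewrite (morM Bm) (antiM Qm) !muA.
- have ψl := yd_entw_linear.
  rewrite [LHS]exchange_tlift [RHS]sw_yd_entw; [|multilinear..].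
  apply: tlift_ext => b1 z.
  under tlift_ext => a1 y do rewrite exchange_tlift.
  rewrite [LHS]exchange_tlift; apply: tlift_ext => b2 b3.
  by rewrite [RHS]sw_yd_entw; [|multilinear..].
Qed.

Lemma yd_entw_unit (c : V) : ψ (𝟙 ⊗ c) = 𝟙 ⊗ c.
Proof.
rewrite yd_entw_tens cop1 tlift_tens; [|multilinear..].
rewrite cop1 tlift_tens; [|multilinear..].
by rewrite (mor1 Bm) (anti1 Qm) mu1l mu1r.
Qed.

Lemma cop_sandwich (c x z : V) :
  Δ (B z • c • Q x)
  = \sw_(z1, z2 <- Δ z) \sw_(c1, c2 <- Δ c) \sw_(x1, x2 <- Δ x)
      (B z1 • c1 • Q x2 ⊗ (B z2 • c2 • Q x1)).
Proof.
have L := tmul_linearl; have R := tmul_linearr.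
rewrite !cop_tmul (mor_cop Bm) (anti_cop Qm).
rewrite (linear_tlift (L _)) [LHS](linear_tlift (L _)).
apply: tlift_ext => z1 z2; rewrite /tmul.
rewrite [X in tlift _ X = _]tlift_tens; [|multilinear..].
rewrite [LHS]tlift_tlift; [|multilinear..].
apply: tlift_ext => c1 c2.
rewrite [LHS]tlift_tens; [|multilinear..].
rewrite [LHS]tlift_tlift; [|multilinear..].
by apply: tlift_ext => x1 x2; rewrite tlift_tens; [|multilinear..].
Qed.

(** Both sides are [h_3 ⊗ B(h_4) c_1 Q(h_2) ⊗ B(h_5) c_2 Q(h_1)]; on the right
    the pair around [c_2] is split off first, which is the bracketing that
    [sw_coassoc5] produces. *)
Lemma yd_entw_cop (h c : V) :
  \sw_(h', c' <- ψ (h ⊗ c)) (h' ⊗ Δ c')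
  = \sw_(c1, c2 <- Δ c) \sw_(h', d2 <- ψ (h ⊗ c2))
      \sw_(h'', d1 <- ψ (h' ⊗ c1)) (h'' ⊗ (d1 ⊗ d2)).
Proof.
have ψl := yd_entw_linear.
transitivity (
    \sw_(c1, c2 <- Δ c) \sw_(x, y <- Δ h) \sw_(h1, h2 <- Δ x)
      \sw_(h3, z <- Δ y) \sw_(h4, h5 <- Δ z)
        (h3 ⊗ (B h4 • c1 • Q h2 ⊗ (B h5 • c2 • Q h1)))).
- rewrite [LHS]sw_yd_entw; [|multilinear..].
  rewrite [RHS]exchange_tlift; apply: tlift_ext => x y.
  apply: esym; under tlift_ext => c1 c2 do rewrite exchange_tlift.
  rewrite [LHS]exchange_tlift; apply: tlift_ext => h3 z.
  under tlift_ext => c1 c2 do rewrite exchange_tlift.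
  rewrite [LHS]exchange_tlift cop_sandwich.
  rewrite [RHS](linear_tlift (tens_linearr h3)).
  apply: tlift_ext => z1 z2; rewrite [RHS](linear_tlift (tens_linearr h3)).
  apply: tlift_ext => c1 c2; rewrite [RHS](linear_tlift (tens_linearr h3)).
  by apply: tlift_ext.
- apply: tlift_ext => c1 c2.
  rewrite [LHS]sw_coassoc5; [|multilinear..].
  rewrite [RHS]sw_yd_entw; [|multilinear..].
  apply: tlift_ext => h1 y; apply: tlift_ext => z h5.
  by rewrite [RHS]sw_yd_entw; [|multilinear..].
Qed.

Lemma yd_entw_eps (h c : V) :
  \sw_(h', c' <- ψ (h ⊗ c)) (ε c' *: h') = ε c *: h.
Proof.
rewrite sw_yd_entw; [|multilinear..].
rewrite -[in RHS](cop_epsl K h) (linear_tlift (linear_scale _)).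
apply: tlift_ext => h1 y.
under tlift_ext => h2 h3 do
  rewrite !epsM (mor_eps Bm) (anti_eps Qm) -mulrA -scalerA.
rewrite (sw_epsr (f := fun h2 => (ε c * ε h1) *: h2)); last by multilinear.
by rewrite scalerA.
Qed.

(** Applied to the structure automorphism of a Hom-bialgebra, this brings its
    twisted axioms down to the untwisted ones. *)
Lemma yd_entw_natural (f : V -> V) (a c : V) :
    bialg_morphism K f -> (forall x, f (B x) = B (f x)) ->
    (forall x, f (Q x) = Q (f x)) ->
  ψ (f a ⊗ f c) = \sw_(a', c' <- ψ (a ⊗ c)) (f a' ⊗ f c').
Proof.
move=> fm fB fQ; have fl := mor_linear fm.
rewrite [RHS]sw_yd_entw; [|multilinear..].
rewrite yd_entw_tens (mor_cop fm) [LHS]tlift_tlift; [|multilinear..].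
apply: tlift_ext => a1 y; rewrite [LHS]tlift_tens; [|multilinear..].
rewrite (mor_cop fm) [LHS]tlift_tlift; [|multilinear..].
apply: tlift_ext => a2 a3; rewrite [LHS]tlift_tens; [|multilinear..].
by rewrite !(morM fm) fB fQ.
Qed.

End Entwining.

(** * The antipode is an anti-morphism *)

Record is_antipode (S : V -> V) : Prop := IsAntipode {
  antipode_linear : linear S;
  antipode_mull : forall h, \sw_(x, y <- Δ h) (S x • y) = ε h *: 𝟙;
  antipode_mulr : forall h, \sw_(x, y <- Δ h) (x • S y) = ε h *: 𝟙
}.

Section Antipode.
Variable S : V -> V.
Hypothesis HS : is_antipode S.
Let Sl : linear S := antipode_linear HS.

(** [S(a_1 b_1) (a_2 b_2) (S(b_3) S(a_3))], evaluated in two ways: cancelling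
    the last two factors leaves [S(a b)], cancelling the first two leaves
    [S(b) S(a)]. *)
Lemma antipode_mul (a b : V) : S (a • b) = S b • S a.
Proof.
transitivity (
    \sw_(x, y <- Δ a) \sw_(z, w <- Δ b) \sw_(y1, y2 <- Δ y)
      \sw_(w1, w2 <- Δ w) (S (x • z) • (y1 • w1 • (S w2 • S y2)))).
- transitivity (
    \sw_(x, y <- Δ a) \sw_(z, w <- Δ b) (ε y *: (ε w *: S (x • z)))).
    rewrite -[in LHS](sw_epsr (f := fun x => S (x • b))); last by multilinear.
    apply: tlift_ext => x y; rewrite -[RHS](linear_tlift (linear_scale _)).
    by rewrite (sw_epsr (f := fun z => S (x • z))); last by multilinear.
  apply: tlift_ext => x y; apply: tlift_ext => z w; apply: esym.
  have gl y1 y2 : linear (fun v => S (x • z) • (y1 • v • S y2)) by multilinear.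
  have fl : linear (fun v => ε w *: (S (x • z) • v)) by multilinear.
  transitivity (\sw_(y1, y2 <- Δ y) (ε w *: (S (x • z) • (y1 • S y2)))).
    apply: tlift_ext => y1 y2.
    transitivity (\sw_(w1, w2 <- Δ w) (S (x • z) • (y1 • (w1 • S w2) • S y2))).
      by apply: tlift_ext => w1 w2; rewrite !muA.
    rewrite -[LHS](linear_tlift (gl y1 y2)) (antipode_mulr HS).
    by rewrite (linear_scaleE (gl y1 y2)) mu1r.
  rewrite -[LHS](linear_tlift fl) (antipode_mulr HS).
  by rewrite (linear_scaleE fl) mu1r.
- transitivity (
    \sw_(x, y <- Δ a) \sw_(z, w <- Δ b) \sw_(x1, x2 <- Δ x)
      \sw_(z1, z2 <- Δ z) (S (x1 • z1) • (x2 • z2) • (S w • S y))).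
    under tlift_ext => x y do rewrite exchange_tlift.
    rewrite [LHS](sw_coassoc (F := fun x y1 y2 => \sw_(z, w <- Δ b)
      \sw_(w1, w2 <- Δ w) (S (x • z) • (y1 • w1 • (S w2 • S y2)))));
      [|multilinear..].
    apply: tlift_ext => x y; rewrite -[LHS]exchange_tlift.
    rewrite [RHS]exchange_tlift [LHS]exchange_tlift.
    apply: tlift_ext => x1 x2.
    rewrite [LHS](sw_coassoc (F := fun z w1 w2 =>
      S (x1 • z) • (x2 • w1 • (S w2 • S y)))); [|multilinear..].
    apply: tlift_ext => z w; apply: tlift_ext => z1 z2.
    by rewrite !muA.
  transitivity (
    \sw_(x, y <- Δ a) \sw_(z, w <- Δ b) (ε x *: (ε z *: (S w • S y)))).
    apply: tlift_ext => x y; apply: tlift_ext => z w.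
    have gl : linear (fun u => u • (S w • S y)) by multilinear.
    rewrite -[LHS](sw_copM (F := fun p q => S p • q • (S w • S y)));
      [|multilinear..].
    rewrite -[LHS](linear_tlift gl) (antipode_mull HS) (linear_scaleE gl).
    by rewrite mu1l epsM scalerA.
  rewrite -[RHS](sw_epsl (f := fun y => S b • S y)); last by multilinear.
  apply: tlift_ext => x y; rewrite -[LHS](linear_tlift (linear_scale _)).
  by rewrite (sw_epsl (f := fun w => S w • S y)); last by multilinear.
Qed.

Lemma antipode_unit : S 𝟙 = 𝟙.
Proof.
have := antipode_mull HS 𝟙; rewrite cop1 tlift_tens; [|multilinear..].
by rewrite mu1r eps1 scale1r.
Qed.

(** Apply the counit to [S(h_1) h_2 = ε(h) 1]. *)
Lemma antipode_eps (h : V) : ε (S h) = ε h.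
Proof.
(* The Sweedler calculus takes values in modules, so scalars are read in the
   regular module [k^o]. *)
have el : linear (ε : V -> k^o) by apply: eps_linear.
have := congr1 (ε : V -> k^o) (antipode_mull HS h).
rewrite (linear_tlift el) (linear_scaleE el) eps1 [RHS]mulr1 => <-.
have eSl : linear (fun x => ε (S x) : k^o) by move=> a x y; rewrite Sl el.
apply: etrans (esym (sw_epsr h eSl)) _; apply: (tlift_ext (U := k^o)) => x y.
by rewrite epsM [RHS]mulrC.
Qed.

(** The dual computation, in the algebra [V ⊗ V]:
    [Δ(S h_1) Δ(h_2) (S h_4 ⊗ S h_3)] is [Δ(S h)] after cancelling on the right
    and [S h_2 ⊗ S h_1] after cancelling on the left. *)
Lemma antipode_cop (h : V) : Δ (S h) = \sw_(x, y <- Δ h) (S y ⊗ S x).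
Proof.
have L := tmul_linearl; have R := tmul_linearr.
rewrite -[RHS]/((fun y => \sw_(y1, y2 <- Δ y) (S y2 ⊗ S y1)) h).
set τ := (fun y => \sw_(y1, y2 <- Δ y) (S y2 ⊗ S y1)).
have τl : linear τ by rewrite /τ; multilinear.
have τE y : τ y = \sw_(y1, y2 <- Δ y) (S y2 ⊗ S y1) by [].
have ΔSl : linear (fun x => Δ (S x)) by multilinear.
(* From here on only the linearity of [τ] and [τE] matter; an opaque [τ] keeps
   unification from unfolding it. *)
clearbody τ.
(* [h_1 S(h_4) ⊗ h_2 S(h_3)]: the inner pair cancels first. *)
have inner y : \sw_(y1, y2 <- Δ y) tmul (Δ y1) (τ y2) = ε y *: (𝟙 ⊗ 𝟙).
  transitivity (\sw_(y1, y2 <- Δ y) \sw_(p, q <- Δ y1) \sw_(r, s <- Δ y2)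
    (p • S s ⊗ q • S r)).
    apply: tlift_ext => y1 y2; apply: tlift_ext => p q.
    rewrite τE [LHS]tlift_tlift; [|multilinear..].
    by apply: tlift_ext => r s; rewrite tlift_tens; [|multilinear..].
  apply: (etrans (esym (sw_coassoc (F := fun p q y2 =>
    \sw_(r, s <- Δ y2) (p • S s ⊗ q • S r)) _ _ _ _))); [multilinear..|].
  transitivity (\sw_(p, t <- Δ y) (p • S t ⊗ 𝟙)); last first.
    rewrite -[LHS](linear_tlift (tens_linearl 𝟙)) (antipode_mulr HS).
    exact: (linear_scaleE (tens_linearl 𝟙)).
  apply: tlift_ext => p t.
  apply: (etrans (sw_coassoc (F := fun q r s => p • S s ⊗ q • S r) _ _ _ _));
    [multilinear..|].
  rewrite -[RHS](sw_epsl (f := fun s => p • S s ⊗ 𝟙)); last by multilinear.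
  apply: tlift_ext => v s.
  rewrite -[LHS](linear_tlift (tens_linearr _)) (antipode_mulr HS).
  exact: (linear_scaleE (tens_linearr _)).
transitivity (\sw_(x, y <- Δ h) \sw_(y1, y2 <- Δ y)
  tmul (Δ (S x)) (tmul (Δ y1) (τ y2))).
- rewrite -[LHS](sw_epsr h ΔSl); apply: tlift_ext => x y.
  rewrite -[RHS](linear_tlift (R _)) inner (linear_scaleE (R _)).
  by rewrite tmul1r.
- apply: (etrans (sw_coassoc (F := fun x y1 y2 =>
    tmul (Δ (S x)) (tmul (Δ y1) (τ y2))) _ _ _ _)); [multilinear..|].
  rewrite -[RHS](sw_epsl h τl); apply: tlift_ext => x y.
  under tlift_ext => x1 x2 do rewrite tmulA -cop_tmul.
  rewrite -(linear_tlift (L _)) -(linear_tlift (@cop_linear _ _ K)).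
  rewrite (antipode_mull HS) (linear_scaleE (@cop_linear _ _ K)) cop1.
  by rewrite (linear_scaleE (L _)) tmul1l.
Qed.

Lemma antipode_antimorphism : bialg_antimorphism K S.
Proof.
by split; [exact: Sl | exact: antipode_mul | exact: antipode_unit
          | exact: antipode_cop | exact: antipode_eps].
Qed.

End Antipode.

Lemma inverse_antimorphism (S T : V -> V) :
  cancel S T -> cancel T S -> bialg_antimorphism K S -> bialg_antimorphism K T.
Proof.
move=> SK TK [Sl SM S1 Scop Seps].
have Sinj := can_inj SK.
have Tl : linear T by move=> a x y; apply: Sinj; rewrite Sl !TK.
split; first exact: Tl.
- by move=> a b; apply: Sinj; rewrite SM !TK.
- by apply: Sinj; rewrite TK S1.
- move=> h; rewrite -[h in RHS]TK Scop [RHS]tlift_tlift; [|multilinear..].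
  rewrite -[LHS]tlift_eta; apply: tlift_ext => x y.
  by rewrite tlift_tens ?SK; [|multilinear..].
- by move=> h; rewrite -[h in RHS]TK Seps.
Qed.

Lemma comp_antimorphism (f g : V -> V) :
    bialg_morphism K f -> bialg_antimorphism K g ->
  bialg_antimorphism K (fun x => f (g x)).
Proof.
move=> [fl fM f1 fcop feps] [gl gM g1 gcop geps]; split.
- exact: linear_comp fl gl.
- by move=> a b; rewrite gM fM.
- by rewrite g1 f1.
- move=> h; rewrite fcop gcop [LHS]tlift_tlift; [|multilinear..].
  by apply: tlift_ext => x y; rewrite tlift_tens; [|multilinear..].
- by move=> h; rewrite feps geps.
Qed.

End Bialgebra.

(** * Untwisting a Hom-bialgebra *)

Section Untwisting.
Variables (k : fieldType) (H : homBialgType k).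

Let tl : linear (twist : H -> H) := linearP _.
Let Δl : linear (hcomul : H -> (H ⊗ H)%type) := linearP _.

Lemma untwist_linear (M : homModType k) : linear (untwist : M -> M).
Proof.
by move=> a x y; apply: (can_inj twistK); rewrite linearP !untwistK.
Qed.
Let ul : linear (untwist : H -> H) := @untwist_linear H.

Lemma untwistM (a b : H) : untwist (hmul a b) = hmul (untwist a) (untwist b).
Proof. by apply: (can_inj twistK); rewrite twistM !untwistK. Qed.

Definition umul (a b : H) : H := untwist (hmul a b).
Definition ucop (h : H) : (H ⊗ H)%type := hcomul (twist h).

Lemma umul_linearl (b : H) : linear (umul^~ b).
Proof. exact: linear_comp ul (hmul_linearl b). Qed.

Lemma umul_linearr (a : H) : linear (umul a).
Proof. exact: linear_comp ul (hmul_linearr a). Qed.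

Lemma ucop_linear : linear ucop.
Proof. exact: linear_comp Δl tl. Qed.

Lemma umulA a b c : umul a (umul b c) = umul (umul a b) c.
Proof.
rewrite /umul -{1}[a]twistK -[in RHS](twistK c) -!untwistM.
by rewrite hmulA.
Qed.

Lemma umul1l a : umul hone a = a.
Proof. by rewrite /umul hmul1l twistK. Qed.

Lemma umul1r a : umul a hone = a.
Proof. by rewrite /umul hmul1 twistK. Qed.

Lemma ucopE (h : H) :
  ucop h = \sw_(x, y <- hcomul h) (twist x ⊗ twist y).
Proof. exact: hcomul_twist. Qed.

(** The map [G] is [α ⊗ (α ⊗ α)], which clears the inverses of [α] from the
    twisted coassociativity law at [α h]. *)
Lemma ucopA h :
  \sw_(x, y <- ucop h) (x ⊗ ucop y)
  = \sw_(x, y <- ucop h) \sw_(x1, x2 <- ucop x) (x1 ⊗ (x2 ⊗ y)).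
Proof.
pose G (x : H) (s : (H ⊗ H)%type) :=
  twist x ⊗ \sw_(a, b <- s) (twist a ⊗ twist b).
have G1 s : linear (fun x => G x s) by rewrite /G; multilinear.
have G2 x : linear (G x) by rewrite /G; multilinear.
have GE x s : G x s = twist x ⊗ \sw_(a, b <- s) (twist a ⊗ twist b) by [].
clearbody G.
have E := etrans (esym (tlift_tlift _ _ G1 G2)) (etrans
  (congr1 (tlift G) (hcomulA (twist h))) (tlift_tlift _ _ G1 G2)).
apply: etrans (etrans _ E) _ => {E}.
  apply: tlift_ext => x y; rewrite tlift_tens; [|multilinear..].
  by rewrite GE untwistK ucopE.
apply: tlift_ext => x y; rewrite [LHS](tlift_tlift _ _ G1 G2).
rewrite ucopE [RHS]tlift_tlift; [|multilinear..].
apply: tlift_ext => x1 x2; rewrite [LHS]tlift_tens; [|multilinear..].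
rewrite [RHS]tlift_tens; [|multilinear..].
by rewrite GE tlift_tens ?untwistK; [|multilinear..].
Qed.

Lemma ucop_epsr h : \sw_(x, y <- ucop h) (hcounit y *: x) = h.
Proof. exact: etrans (hcounitr _) (twistK _). Qed.

Lemma ucop_epsl h : \sw_(x, y <- ucop h) (hcounit x *: y) = h.
Proof. exact: etrans (hcounitl _) (twistK _). Qed.

Lemma ucopM a b :
  ucop (umul a b)
  = \sw_(a1, a2 <- ucop a) \sw_(b1, b2 <- ucop b) (umul a1 b1 ⊗ umul a2 b2).
Proof.
have L := umul_linearl; have R := umul_linearr.
have -> : ucop (umul a b) = hcomul (hmul a b) by rewrite /ucop untwistK.
rewrite hcomulM !ucopE.
rewrite [RHS]tlift_tlift; [|multilinear..].
apply: tlift_ext => a1 a2; rewrite [RHS]tlift_tens; [|multilinear..].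
rewrite [RHS]tlift_tlift; [|multilinear..].
apply: tlift_ext => b1 b2; rewrite [RHS]tlift_tens; [|multilinear..].
by rewrite /umul -!twistM !twistK.
Qed.

Lemma ucop1 : ucop hone = hone ⊗ hone.
Proof. by rewrite /ucop twist1 hcomul1. Qed.

Lemma hcounit_untwist (h : H) : hcounit (untwist h) = hcounit h.
Proof. by rewrite -[in RHS](untwistK h) hcounit_twist. Qed.

Lemma ucounitM a b : hcounit (umul a b) = hcounit a * hcounit b.
Proof. by rewrite hcounit_untwist hcounitM. Qed.

Definition untwisted : bialgebra H :=
  Bialgebra umul_linearl umul_linearr ucop_linear (linearP (@hcounit _ H))
    umulA umul1l umul1r ucopA ucop_epsr ucop_epsl ucopM ucop1 ucounitM
    (@hcounit1 _ H).

Lemma twist_morphism : bialg_morphism untwisted twist.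
Proof.
split=> [|a b||h|h] /=.
- exact: tl.
- by rewrite /umul -twistM twistK untwistK.
- exact: twist1.
- by rewrite /ucop hcomul_twist.
- exact: hcounit_twist.
Qed.

End Untwisting.

(** * Untwisting the antipode and the automorphisms *)

Section UntwistingHopf.
Variables (k : fieldType) (H : homHopfType k).
Local Notation K := (untwisted H).

Lemma untwist1 : untwist (hone : H) = hone.
Proof. by rewrite -{1}[hone]twist1 twistK. Qed.

Lemma untwisted_antipode : is_antipode K antipode.
Proof.
have ul := @untwist_linear k H.
split=> [|h|h] /=; first exact: linearP.
- rewrite -(linear_tlift ul) antipodel hcounit_twist.
  by rewrite (linear_scaleE ul) untwist1.
- rewrite -(linear_tlift ul) antipoder hcounit_twist.
  by rewrite (linear_scaleE ul) untwist1.
Qed.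

Lemma aut_untwist (A : homHopfAut H) h : A (untwist h) = untwist (A h).
Proof. by apply: (can_inj twistK); rewrite -aut_twist !untwistK. Qed.

Lemma aut_morphism (A : homHopfAut H) : bialg_morphism K A.
Proof.
split=> [|a b||h|h] /=.
- exact: linearP.
- by rewrite /umul aut_untwist autM.
- exact: aut1.
- by rewrite /ucop -aut_twist aut_comul.
- exact: aut_counit.
Qed.

Section InverseAntipode.
Variable Sinv : H -> H.
Hypotheses (SK : cancel (antipode : H -> H) Sinv)
           (SinvK : cancel Sinv (antipode : H -> H)).
Variables A B : homHopfAut H.
Let Q (h : H) := A (Sinv h).

Lemma Sinv_twist h : Sinv (twist h) = twist (Sinv h).
Proof. by apply: (can_inj SK); rewrite antipode_twist !SinvK. Qed.

Lemma aut_Sinv_antimorphism : bialg_antimorphism K Q.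
Proof.
apply: comp_antimorphism (aut_morphism A) _.
exact: inverse_antimorphism SK SinvK (antipode_antimorphism untwisted_antipode).
Qed.

(** With [Δ(h) = α h_1 ⊗ α h_2], the ordinary components of [a] are [α a_1],
    [α^2 a_21] and [α^2 a_22]; the two inverses of [α] from the products
    [(B(α^2 a_22) c) Q(α a_1)] absorb all of these powers but the one on the
    middle component, and leave [α^-2] on [c]. *)
Lemma entw_mapE t : entw_map Sinv A B t = yd_entw K B Q t.
Proof.
have tl : linear (twist : H -> H) by apply: linearP.
have Bl : linear B := mor_linear (aut_morphism B).
have Ql : linear Q := anti_linear aut_Sinv_antimorphism.
have ml := @umul_linearl k H; have mr := @umul_linearr k H.
have cl := @ucop_linear k H.
have Qt x : Q (twist x) = twist (Q x) by rewrite /Q Sinv_twist aut_twist.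
apply: tlift_ext => a c; rewrite /= ucopE.
rewrite [RHS]tlift_tlift; [|multilinear..].
apply: tlift_ext => a1 y.
rewrite [RHS]tlift_tens; [|multilinear..].
rewrite /ucop hcomul_twist -/(ucop y) ucopE.
rewrite [RHS]tlift_tlift; [|multilinear..].
rewrite [RHS]tlift_tlift; [|multilinear..].
apply: tlift_ext => a2 a3.
rewrite [RHS]tlift_tens; [|multilinear..].
rewrite [RHS]tlift_tens; [|multilinear..].
by rewrite Qt /umul !(aut_twist B) !untwistM !twistK.
Qed.

End InverseAntipode.
End UntwistingHopf.

(** * The Hom-entwining *)

Theorem proposition2p7 (k : fieldType) (H : homHopfType k)
    (Sinv : H -> H)
    (SK : cancel (antipode : H -> H) Sinv)
    (SinvK : cancel Sinv (antipode : H -> H))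
    (A B : homHopfAut H) :
  hom_entwining (entw_map Sinv A B).
Proof.
pose Q h := A (Sinv h).
have Bm := aut_morphism B.
have Qm : bialg_antimorphism (untwisted H) Q := aut_Sinv_antimorphism SK SinvK A.
have ψE t : entw_map Sinv A B t = yd_entw (untwisted H) B Q t.
  exact: entw_mapE.
have tB h : twist (B h) = B (twist h) by rewrite aut_twist.
have tQ h : twist (Q h) = Q (twist h).
  by rewrite /Q (Sinv_twist SK SinvK) aut_twist.
have ψt h c := yd_entw_natural Bm Qm h c (twist_morphism H) tB tQ.
have tl : linear (twist : H -> H) by apply: linearP.
have Δl : linear (hcomul : H -> (H ⊗ H)%type) by apply: linearP.
have hl := @hmul_linearl k H; have hr := @hmul_linearr k H.
have ψl := yd_entw_linear Bm Qm.
set ψ := entw_map Sinv A B in ψE *.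
clearbody Q.
split.
- by move=> a s t; rewrite !ψE ψl.
- move=> h g c.
  have -> : hmul h g = twist (umul h g) by rewrite /umul untwistK.
  rewrite -{1}[c]untwistK ψE ψt (yd_entw_mul Bm Qm).
  rewrite ψE [LHS]tlift_tlift; [|multilinear..].
  apply: tlift_ext => g' d.
  rewrite ψE [LHS]tlift_tlift; [|multilinear..].
  apply: tlift_ext => h' e.
  rewrite [LHS]tlift_tens; [|multilinear..].
  by rewrite /umul untwistK.
- by move=> c; rewrite ψE (yd_entw_unit Bm Qm).
- move=> h c.
  pose F (x : H) (s : (H ⊗ H)%type) := twist x ⊗ s.
  have F1 s : linear (fun x => F x s) by rewrite /F; multilinear.
  have F2 x : linear (fun s => F x s) by rewrite /F; multilinear.
  (* The ordinary law at [α^-1 h] and [α^-1 c], with [α] applied to its first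
     factor. *)
  have E := etrans (esym (tlift_tlift _ _ F1 F2)) (etrans
    (congr1 (tlift F) (yd_entw_cop Bm Qm (untwist h) (untwist c)))
    (tlift_tlift _ _ F1 F2)).
  rewrite -[h in LHS]untwistK -[c in LHS]untwistK ψE ψt [LHS]tlift_tlift;
    [|multilinear..].
  apply: etrans (etrans _ E) _ => {E}.
    apply: tlift_ext => x y; rewrite [LHS]tlift_tens; [|multilinear..].
    by rewrite [RHS]tlift_tens; [|multilinear..].
  rewrite /= /ucop untwistK; apply: tlift_ext => c1 c2.
  rewrite ψE [LHS](tlift_tlift _ _ F1 F2); apply: tlift_ext => h' d2.
  rewrite ψE [LHS](tlift_tlift _ _ F1 F2); apply: tlift_ext => h'' d1.
  by rewrite tlift_tens.
- by move=> h c; rewrite ψE (yd_entw_eps Bm Qm).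
Qed.
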